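(* $T(5,3,2)=13$.
   Context: For integers $d\geq 1$ and $2\leq k\leq r$, $T(d,r,k)$ denotes the smallest positive integer $n$ with the following property: for any list $a_1,\dots,a_n$ of (not necessarily distinct) points in $\mathbb{R}^d$, there is a partition of the index set $\{1,\dots,n\}$ into $r$ disjoint parts $N_1,\dots,N_r$ such that every $k$ of the $r$ convex hulls $\mathrm{conv}\{a_i : i\in N_j\}$ ($j=1,\dots,r$) have a point in common. *)

(* Defs.v *)
From mathcomp Require Import all_boot all_order all_algebra.
From mathcomp Require Import boolp classical_sets reals convex.

Set Implicit Arguments.
Unset Strict Implicit.
Unset Printing Implicit Defensive.

Local Open Scope classical_set_scope.
Local Open Scope ring_scope.

Definition convex_hull (R : realType) (M : lmodType R) (A : set M) : set M :=
  smallest (@convex_set R M) A.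

(* [classical_sets.partition] also requires the parts to be nonempty; this is
   no restriction for 1 <= k <= r, as every part is then one of some k parts
   whose convex hulls have a point in common. *)
Definition has_tverberg_partition (R : realType) (d r k n : nat)
    (a : 'I_n -> 'rV[R]_d) : Prop :=
  exists2 N : 'I_r -> set 'I_n,
    classical_sets.partition [set: 'I_r] N [set: 'I_n] &
    forall J : {set 'I_r}, #|J| = k ->
      \bigcap_(j in [set` J]) convex_hull (a @` N j) !=set0.

Definition tverberg_property (R : realType) (d r k n : nat) : Prop :=
  forall a : 'I_n -> 'rV[R]_d, has_tverberg_partition r k a.

(* The default value 0 of [xget] is not a positive integer, so an equation
   [T R d r k = n] with 0 < n does assert that n is the least element. *)
Definition T (R : realType) (d r k : nat) : nat :=
  xget 0%N [set n | [/\ (0 < n)%N, tverberg_property R d r k n &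
    forall m, (0 < m)%N -> tverberg_property R d r k m -> (n <= m)%N]].

(* Main.v *)
(** Upper bound: Tverberg's theorem, by Sarkaria's argument. Tensoring the points
    [(a_i, 1)] with [s + 1] vectors whose only linear relation is that their sum
    vanishes turns a Tverberg partition into a colourful choice whose convex hull
    contains the origin, which exists by Barany's theorem.

    Lower bound: take the six vertices [p_i] of a 5-simplex and, close to each
    [p_i], an interior point [q_i]. If the hulls of two parts meet, the relation
    between their points is, to first order, carried by the clusters
    [{p_i, q_i}] which these two parts share, and its sign at any other cluster is
    prescribed by the part to which that cluster gives no point. As the
    displacements [q_i - p_i] have all off-diagonal coordinates positive, a single
    shared cluster cannot produce both signs, so every pair of parts shares exactly
    two of the six clusters. For two shared clusters [a], [a'] the signs force the
    ratios of the displacements of [a] and [a'] to separate the two other pairs of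
    clusters, and the displacements are chosen so that no perfect matching of the
    six clusters has this property for all of its three edges. *)
Require Import Defs.
From mathcomp Require Import all_boot all_order all_algebra.
From mathcomp Require Import boolp classical_sets reals convex.
From mathcomp Require Import interval_inference topology function_spaces.
From mathcomp Require Import normedtype derive.
From mathcomp Require Import zify ring lra.

Set Implicit Arguments.
Unset Strict Implicit.
Unset Printing Implicit Defensive.

Import Order.TTheory GRing.Theory Num.Theory.
Import numFieldNormedType.Exports.
Local Open Scope classical_set_scope.
Local Open Scope ring_scope.

(** * Convex hulls *)

Lemma convex_setP (R : numDomainType) (M : lmodType R) (C : set M) :
  convex_set C <-> forall x y (k : R), 0 <= k <= 1 -> C x -> C y ->
    C (k *: x + (1 - k) *: y).
Proof.
split=> [cC x y k /andP[k0 k1] Cx Cy|cC x y k /set_mem Cx /set_mem Cy].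
  have := cC x y (Itv01 k0 k1) (mem_set Cx) (mem_set Cy).
  by move/set_mem.
by apply/mem_set; apply: cC => //; rewrite ge0 le1.
Qed.

Lemma convex_comb (R : numFieldType) (M : lmodType R) (C : set M) (n : nat)
    (t : 'I_n -> R) (a : 'I_n -> M) :
  convex_set C -> (forall i, 0 <= t i) -> \sum_i t i = 1 ->
  (forall i, t i != 0 -> C (a i)) -> C (\sum_i t i *: a i).
Proof.
move=> /convex_setP cC t0 t1 aC.
(* Partial sums are divided by their total weight, so that induction on the list stays within convex
   combinations. *)
suff H (s : seq 'I_n) : 0 < \sum_(i <- s) t i ->
    C ((\sum_(i <- s) t i)^-1 *: \sum_(i <- s) t i *: a i).
  by have := H (index_enum _); rewrite t1 invr1 scale1r; apply.
elim: s => [|i s IHs]; rewrite ?big_nil ?ltxx// !big_cons.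
have [ti0|ti0] := eqVneq (t i) 0; first by rewrite ti0 scale0r !add0r.
have [s0 _|s0 ps] := eqVneq (\sum_(j <- s) t j) 0.
  have -> : \sum_(j <- s) t j *: a j = 0.
    apply: big1_seq => j /andP[_ js]; move/eqP: s0.
    by rewrite psumr_eq0// => /allP/(_ j js)/eqP->; rewrite scale0r.
  by rewrite s0 !addr0 scalerA mulVf// scale1r; exact: aC.
set S := \sum_(j <- s) t j in s0 ps IHs *.
have S0 : 0 < S by rewrite lt_neqAle eq_sym s0 sumr_ge0.
set T := \sum_(j <- s) _.
have -> : (t i + S)^-1 *: (t i *: a i + T) =
    (t i / (t i + S)) *: a i + (1 - t i / (t i + S)) *: (S^-1 *: T).
  rewrite scalerDr !scalerA [_^-1 * t i]mulrC; congr (_ + _ *: _).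
  by field; rewrite s0 gt_eqF.
apply: cC; [|exact: aC|exact: IHs].
have tiS : 0 < t i + S by rewrite ltr_wpDl.
by rewrite divr_ge0 ?(ltW tiS)//= ler_pdivrMr// mul1r lerDl ltW.
Qed.

(** The combinations supported on [A] form a convex set. The weights live on all of ['I_n], so that
    those of different parts can be subtracted. *)
Lemma convex_hullP (R : realType) (M : lmodType R) (n : nat) (a : 'I_n -> M)
    (A : set 'I_n) (z : M) :
  convex_hull (a @` A) z <-> exists t : 'I_n -> R,
    [/\ forall i, 0 <= t i, forall i, t i != 0 -> A i, \sum_i t i = 1 &
        z = \sum_i t i *: a i].
Proof.
split=> [|[t [t0 tA t1 ->]] C [cC AC]]; last first.
  by apply: convex_comb => // i /tA Ai; apply: AC; exists i.
pose C := [set z : M | exists t : 'I_n -> R,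
  [/\ forall i, 0 <= t i, forall i, t i != 0 -> A i, \sum_i t i = 1 &
      z = \sum_i t i *: a i]].
apply: (@smallest_sub _ _ _ C); last first.
  move=> _ [i Ai <-]; exists (fun j => (j == i)%:R); split=> [j|j||].
  - exact: ler0n.
  - by rewrite pnatr_eq0 eqb0 negbK => /eqP->.
  - by rewrite (bigD1 i)//= eqxx big1 ?addr0// => j /negbTE->.
  - rewrite (bigD1 i)//= eqxx scale1r big1 ?addr0// => j /negbTE->.
    by rewrite scale0r.
apply/convex_setP => _ _ k /andP[k0 k1] [s [s0 sA s1 ->]] [t [t0 tA t1 ->]].
exists (fun i => k * s i + (1 - k) * t i); split=> [i|i||].
- by rewrite addr_ge0 ?mulr_ge0 ?subr_ge0.
- have [si0|/sA//] := eqVneq (s i) 0.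
  have [ti0|/tA//] := eqVneq (t i) 0.
  by rewrite si0 ti0 !mulr0 addr0 eqxx.
- by rewrite big_split/= -!mulr_sumr s1 t1 !mulr1 addrC subrK.
- rewrite !scaler_sumr -big_split/=; apply: eq_bigr => i _.
  by rewrite [RHS]scalerDl !scalerA.
Qed.

(** * Colourful Caratheodory and Tverberg theorems *)

Definition simplex (R : numDomainType) (n : nat) : set 'rV[R]_n :=
  [set t | (forall i, 0 <= t 0 i) /\ \sum_i t 0 i = 1].

Lemma continuous_sum (R : realType) (T : topologicalType) (n : nat)
    (f : 'I_n -> T -> R) :
  (forall i, continuous (f i)) -> continuous (fun t => \sum_i f i t).
Proof.
move=> cf; apply: continuous_big => // xy.
by apply: cvgD; [exact: cvg_fst|exact: cvg_snd].
Qed.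

Lemma compact_simplex (R : realType) (n : nat) : compact (@simplex R n).
Proof.
apply: bounded_closed_compact.
  exists 1; split; first exact: num_real.
  move=> M M1 t [t0 t1]; rewrite /= [leLHS]/Num.norm /= mx_normrE.
  apply/bigmax_leP; split=> [|[i j] _ /=]; first lra.
  rewrite ord1 ger0_norm//; apply: le_trans (ltW M1).
  by rewrite -t1 (bigD1 j)//= lerDl sumr_ge0.
have -> : @simplex R n =
    \bigcap_i [set t : 'rV[R]_n | 0 <= t 0 i] `&` [set t | \sum_i t 0 i = 1].
  apply/seteqP; split=> [t [t0 t1]|t [t0 t1]]; split=> // i.
    by move=> _; exact: t0.
  exact: t0 i I.
apply: closedI.
  apply: closed_bigI => i _.
  apply: (@preimage_closed _ R (fun t : 'rV[R]_n => t 0 i) [set x | 0 <= x]);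
    last exact: closed_ge.
  by move=> t _; exact: coord_continuous.
apply: (@preimage_closed _ R (fun t : 'rV[R]_n => \sum_i t 0 i) [set x | x = 1]);
  last exact: closed_eq.
by move=> t _; apply: continuous_sum => i; exact: coord_continuous.
Qed.

Notation dot u v := ((u *m v^T) 0 0).

Lemma dotE (R : comPzRingType) (n : nat) (u v : 'rV[R]_n) :
  dot u v = \sum_i u 0 i * v 0 i.
Proof. by rewrite mxE; apply: eq_bigr => i _; rewrite mxE. Qed.

Lemma dotC (R : comPzRingType) (n : nat) (u v : 'rV[R]_n) : dot u v = dot v u.
Proof. by rewrite !dotE; apply: eq_bigr => i _; rewrite mulrC. Qed.

Lemma dotDl (R : comPzRingType) (n : nat) (u v w : 'rV[R]_n) :
  dot (u + v) w = dot u w + dot v w.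
Proof. by rewrite mulmxDl mxE. Qed.

Lemma dotZl (R : comPzRingType) (n : nat) a (u w : 'rV[R]_n) :
  dot (a *: u) w = a * dot u w.
Proof. by rewrite -scalemxAl mxE. Qed.

Lemma dot_suml (R : comPzRingType) (n : nat) (I : Type) (r : seq I) (P : pred I)
    (F : I -> 'rV[R]_n) (w : 'rV[R]_n) :
  dot (\sum_(i <- r | P i) F i) w = \sum_(i <- r | P i) dot (F i) w.
Proof. by rewrite mulmx_suml summxE. Qed.

Lemma dot_ge0 (R : realDomainType) (n : nat) (u : 'rV[R]_n) : 0 <= dot u u.
Proof. by rewrite dotE sumr_ge0// => i _; rewrite -expr2 sqr_ge0. Qed.

Lemma dot_eq0 (R : realDomainType) (n : nat) (u : 'rV[R]_n) :
  dot u u = 0 -> u = 0.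
Proof.
rewrite dotE => /eqP; rewrite psumr_eq0 => [/allP u0|i _]; last first.
  by rewrite -expr2 sqr_ge0.
apply/rowP => i; have := u0 i (mem_index_enum i).
by rewrite mxE -expr2 sqrf_eq0 => /eqP.
Qed.

(* Otherwise moving from [z] a little towards [x] shortens [z]. *)
Lemma dot_min (R : realFieldType) (n : nat) (z x : 'rV[R]_n) :
  (forall s, 0 < s <= 1 ->
     dot z z <= dot ((1 - s) *: z + s *: x) ((1 - s) *: z + s *: x)) ->
  dot z z <= dot z x.
Proof.
move=> zmin; rewrite leNgt; apply/negP => zx.
pose c := dot z z - dot z x; pose D := dot (x - z) (x - z).
have c0 : 0 < c by rewrite subr_gt0.
have D0 : 0 <= D := dot_ge0 _.
have cD : 0 < D + c by rewrite ltr_wpDl.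
have /zmin : 0 < c / (D + c) <= 1.
  by rewrite divr_gt0//= ler_pdivrMr// mul1r lerDr.
set s := c / _.
have sE : s * (D + c) = c by rewrite /s divfK ?gt_eqF.
have s0 : 0 < s by rewrite divr_gt0.
have -> : (1 - s) *: z + s *: x = z + s *: (x - z).
  by rewrite scalerBl scale1r scalerBr addrAC addrA.
have dzx : dot z (x - z) = - c.
  by rewrite dotC -[- z]scaleN1r dotDl dotZl mulN1r [dot x z]dotC /c opprB.
rewrite dotDl dotZl ![dot _ (z + _)]dotC !dotDl !dotZl -/D [dot (x - z) z]dotC dzx.
nra.
Qed.

Lemma simplex_min_norm (R : realType) (n N : nat) (X : 'M[R]_(n.+1, N)) :
  exists2 t, simplex t &
    forall s, simplex s -> dot (t *m X) (t *m X) <= dot (s *m X) (s *m X).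
Proof.
have [|||t /set_mem st tmin] :=
    @EVT_min_rV R _ (fun t => dot (t *m X) (t *m X)) (@simplex R n.+1).
- exists (delta_mx 0 0); split=> [i|]; rewrite ?mxE ?ler0n//.
  by rewrite (bigD1 0)//= big1 ?mxE ?addr0// => i /negbTE i0; rewrite mxE i0.
- exact: compact_simplex.
- apply: continuous_subspaceT.
  have -> : (fun t : 'rV[R]_n.+1 => dot (t *m X) (t *m X)) =
      fun t => \sum_j (\sum_i t 0 i * X i j) * (\sum_i t 0 i * X i j).
    by apply/funext => t; rewrite dotE; apply: eq_bigr => j _; rewrite !mxE.
  apply: continuous_sum => j t.
  have c : continuous (fun t : 'rV[R]_n.+1 => \sum_i t 0 i * X i j).
    apply: continuous_sum => i u; apply: continuousM; last exact: cst_continuous.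
    exact: coord_continuous.
  by apply: continuousM; exact: c.
- by exists t => // s ss; apply: tmin; exact: mem_set.
Qed.

Definition transversal (R : realType) (n N r : nat)
    (x : 'I_n -> 'I_r -> 'rV[R]_N) (c : 'I_n -> 'I_r) : 'M[R]_(n, N) :=
  \matrix_i x i (c i).

Lemma exists_left_kernel (F : fieldType) (n m : nat) (X : 'M[F]_(n, m)) :
  (m < n)%N -> exists2 u : 'rV_n, u != 0 & u *m X = 0.
Proof.
move=> mn; have : kermx X != 0.
  rewrite kermx_eq0 -row_leq_rank -ltnNge.
  exact: leq_ltn_trans (rank_leq_col _) mn.
by case/rowV0Pn => u /sub_kermxP uX u0; exists u.
Qed.

(* Moving along an affine dependence until a weight vanishes. *)
Lemma simplex_drop_weight (R : realFieldType) (n N : nat) (t : 'rV[R]_n)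
    (X : 'M[R]_(n, N)) (u : 'rV[R]_n) :
  simplex t -> u != 0 -> u *m X = 0 -> \sum_i u 0 i = 0 ->
  exists t', [/\ simplex t', t' *m X = t *m X & exists k, t' 0 k = 0].
Proof.
move=> [t0 t1] u0 uX us.
have [k uk] : exists k, u 0 k < 0.
  apply/existsP; apply: contraNT u0 => /existsPn un.
  have /eqP := us; rewrite psumr_eq0 => [/allP u0|i _]; last by rewrite leNgt.
  by apply/eqP/rowP => i; have /eqP := u0 i (mem_index_enum i); rewrite mxE.
case: (@arg_minP _ _ _ k (fun i => u 0 i < 0) (fun i => t 0 i / - u 0 i) uk)
  => {uk}k uk kmin.
pose a := t 0 k / - u 0 k.
have a0 : 0 <= a by rewrite divr_ge0// oppr_ge0 ltW.
exists (t + a *: u); split; last first.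
- exists k; rewrite !mxE /a invrN mulrN mulNr divfK ?subrr//.
  by rewrite lt_eqF.
- by rewrite mulmxDl -scalemxAl uX scaler0 addr0.
split=> [i|]; last first.
  under eq_bigr do rewrite !mxE.
  by rewrite big_split/= -mulr_sumr us mulr0 addr0.
rewrite !mxE; have [ui|ui] := leP 0 (u 0 i); first exact: addr_ge0 (mulr_ge0 _ _).
have := kmin i ui; rewrite -/a ler_pdivlMr ?oppr_gt0// mulrN.
by rewrite -subr_ge0 opprK.
Qed.

(** Barany's argument: take a choice and weights for which [z] has least norm. A colour of weight
    zero may be exchanged freely, which forces [z = 0]; if all weights are positive and [z] is
    nonzero, one of them can be made zero without moving [z]. *)
Lemma colorful_caratheodory (R : realType) (N r : nat)
    (x : 'I_N.+1 -> 'I_r -> 'rV[R]_N) :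
  (forall i, exists2 p : 'I_r -> R, (forall j, 0 <= p j) /\ \sum_j p j = 1 &
     \sum_j p j *: x i j = 0) ->
  exists c (t : 'rV[R]_N.+1), simplex t /\ \sum_i t 0 i *: x i (c i) = 0.
Proof.
move=> x0.
have tX c (t : 'rV[R]_N.+1) :
    t *m transversal x c = \sum_i t 0 i *: x i (c i).
  by rewrite mulmx_sum_row; apply: eq_bigr => i _; rewrite rowK.
pose F (c : {ffun 'I_N.+1 -> 'I_r}) (t : 'rV[R]_N.+1) :=
  dot (t *m transversal x c) (t *m transversal x c).
have /boolp.choice[tm /all_and2[tmS tmP]] : forall c, exists t,
    simplex t /\ forall s, simplex s -> F c t <= F c s.
  by move=> c; have [t st tmin] := simplex_min_norm (transversal x c); exists t.
have r0 : (0 < r)%N.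
  case: r x x0 {tX F tm tmS tmP} => // x /(_ 0)[p [_]].
  by rewrite big_ord0 => /esym/eqP; rewrite oner_eq0.
pose c0 : {ffun 'I_N.+1 -> 'I_r} := [ffun=> Ordinal r0].
case: (@arg_minP _ _ _ c0 xpredT (fun c => F c (tm c)) isT) => c _ cmin.
pose z := tm c *m transversal x c.
suff z0 : z = 0 by exists c, (tm c); rewrite -tX.
have zmin c' s : simplex s -> dot z z <= F c' s.
  by move=> ss; apply: le_trans (cmin c' isT) _; exact: tmP.
(* Replacing the point of colour [k] is free when its weight is zero. *)
have step t k j : simplex t -> z = t *m transversal x c ->
    j = c k \/ t 0 k = 0 -> dot z z <= dot z (x k j).
  move=> [t0 t1] tz jk; apply: dot_min => s /andP[s0 s1].
  pose c' : {ffun 'I_N.+1 -> 'I_r} := [ffun i => if i == k then j else c i].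
  suff -> : (1 - s) *: z + s *: x k j =
      ((1 - s) *: t + s *: delta_mx 0 k) *m transversal x c'.
    apply: zmin; split=> [i|].
      by rewrite !mxE addr_ge0 ?mulr_ge0 ?ler0n ?subr_ge0// ltW.
    under eq_bigr do rewrite !mxE.
    rewrite big_split/= -!mulr_sumr t1 mulr1 (bigD1 k)//= eqxx big1 ?addr0.
      by rewrite mulr1 subrK.
    by move=> i /negbTE->.
  rewrite mulmxDl -!scalemxAl -rowE rowK ffunE eqxx tz !tX.
  congr (_ *: _ + _); apply: eq_bigr => i _.
  rewrite ffunE; have [->|//] := eqVneq i k.
  by case: jk => [->//|->]; rewrite !scale0r.
(* Since 0 is a convex combination of the points of colour [k], averaging the inequality of [step]
   over them gives [dot z z <= 0]. *)
have zero t k : simplex t -> z = t *m transversal x c -> t 0 k = 0 -> z = 0.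
  move=> ts tz tk; apply/dot_eq0/eqP; rewrite eq_le dot_ge0 andbT.
  have [p [p0 p1] px] := x0 k.
  have -> : dot z z = \sum_j p j * dot z z by rewrite -mulr_suml p1 mul1r.
  apply: (@le_trans _ _ (\sum_j p j * dot z (x k j))).
    by apply: ler_sum => j _; rewrite ler_wpM2l// (step t)//; right.
  under eq_bigr do rewrite dotC -dotZl.
  by rewrite -dot_suml px mul0mx mxE.
have [u u0 uX] := exists_left_kernel (transversal x c) (ltnSn N).
have [//|znz] := eqVneq z 0.
have [/existsP[k /eqP tk]|/existsPn tpos] :=
  boolP [exists k, tm c 0 k == 0]; first exact: zero tk.
(* The nonnegative numbers [dot z (x i (c i)) - dot z z] have weighted sum 0, and all weights are
   positive. *)
have zx k : dot z (x k (c k)) = dot z z.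
  have st := step _ _ _ (tmS c) erefl (or_introl erefl).
  have : \sum_i tm c 0 i * (dot z (x i (c i)) - dot z z) = 0.
    under eq_bigr do rewrite mulrBr.
    rewrite sumrB -mulr_suml (tmS c).2 mul1r.
    under eq_bigr do rewrite dotC -dotZl.
    by rewrite -dot_suml -tX subrr.
  move/eqP; rewrite psumr_eq0 => [/allP/(_ k (mem_index_enum k))|i _].
    by rewrite mulf_eq0 (negbTE (tpos k)) subr_eq0 => /eqP.
  by rewrite mulr_ge0 ?subr_ge0 ?(tmS c).1.
(* The points lie on a hyperplane avoiding the origin, so their linear dependence is affine. *)
have us : \sum_i u 0 i = 0.
  have := congr1 (fun v => dot v z) uX.
  rewrite tX dot_suml mul0mx mxE.
  under eq_bigr do rewrite dotZl dotC zx.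
  rewrite -mulr_suml => /eqP; rewrite mulf_eq0 => /orP[/eqP//|/eqP/dot_eq0 z0].
  by rewrite z0 eqxx in znz.
have [t [ts tz [k tk]]] := simplex_drop_weight (tmS c) u0 uX us.
exact: zero tk.
Qed.

(* Sarkaria's trick: [v 0 + ... + v s = 0] is the only linear relation among
   the vectors [v j], so a relation among the [(a i, 1) (x) v (c i)] makes the
   sums of the [t i *: (a i, 1)] over the classes of [c] all equal. *)
Theorem tverberg (R : realType) (d s : nat)
    (a : 'I_((d + 1) * s).+1 -> 'rV[R]_d) :
  exists (c : 'I_((d + 1) * s).+1 -> 'I_s.+1) z,
    forall j, convex_hull (a @` [set i | c i = j]) z.
Proof.
pose b i : 'rV[R]_(d + 1) := row_mx (a i) (const_mx 1).
(* The standard basis followed by minus its sum. *)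
pose v (j : 'I_s.+1) : 'rV[R]_s :=
  \row_k ((val j == val k)%:R - (val j == s)%:R).
have sum_v : \sum_j v j = 0.
  apply/rowP => k; rewrite summxE mxE.
  under eq_bigr do rewrite mxE.
  rewrite sumrB (bigD1 (widen_ord (leqnSn s) k))//= eqxx big1 => [|j]; last first.
    by rewrite -val_eqE/= => /negbTE->.
  rewrite (bigD1 ord_max)//= eqxx big1 => [|j]; last first.
    by rewrite -val_eqE/= => /negbTE->.
  by rewrite addr0 subrr.
have s0 : s.+1%:R != 0 :> R by rewrite pnatr_eq0.
have [i|c [t [[t0 t1] tx]]] :=
    @colorful_caratheodory R _ _ (fun i j => mxvec ((b i)^T *m v j)).
  exists (fun=> s.+1%:R^-1).
    split=> [_|]; first by rewrite invr_ge0.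
    by rewrite sumr_const card_ord -[_ *+ _]mulr_natr mulVf.
  by rewrite -scaler_sumr -linear_sum -mulmx_sumr sum_v mulmx0 linear0 scaler0.
pose G j := \sum_(i | c i == j) t 0 i *: b i.
have GE j : G j = G ord_max.
  have [js|] := ltnP j s; last first.
    move=> sj; congr G; apply/val_inj/eqP.
    by rewrite eqn_leq/= sj andbT -ltnS ltn_ord.
  have {}tx : \sum_i t 0 i *: ((b i)^T *m v (c i)) = 0.
    apply: (can_inj (@mxvecK _ _ _)); rewrite linear0 linear_sum -[RHS]tx.
    by apply: eq_bigr => i _; rewrite linearZ/=.
  (* Column [j] of the tensor relation is [G j - G ord_max]. *)
  apply/eqP; rewrite -subr_eq0; apply/eqP/rowP => l.
  have /matrixP/(_ l (Ordinal js)) := tx.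
  rewrite summxE !mxE => txl; rewrite -[RHS]txl !summxE.
  rewrite big_mkcond [X in _ - X]big_mkcond -sumrB; apply: eq_bigr => i _ /=.
  rewrite -val_eqE -[c i == ord_max]val_eqE/= ![in RHS](big_ord1, mxE) !mxE/=.
  by do 2!case: (_ == _);
    rewrite ?(subr0, sub0r, subrr, mulr0, mulr1, mulrN1, mulrN).
(* The last coordinate of every [b i] is 1, so [q] is the total weight common to all classes. *)
pose q := G ord_max 0 (rshift d 0).
have qE j : \sum_(i | c i == j) t 0 i = q.
  rewrite /q -(GE j) summxE; apply: eq_bigr => i _.
  by rewrite mxE row_mxEr mxE mulr1.
have q0 : q != 0.
  apply: contra_neq (oner_neq0 R) => q0.
  by rewrite -t1 (partition_big c xpredT)//= big1// => j _; rewrite qE.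
have q_ge0 : 0 <= q by rewrite -(qE ord_max) sumr_ge0.
exists c, (q^-1 *: lsubmx (G ord_max)) => j; apply/convex_hullP.
exists (fun i => if c i == j then q^-1 * t 0 i else 0); split=> [i|i||].
- by case: ifP => // _; rewrite mulr_ge0 ?invr_ge0.
- by case: ifP => [/eqP//|_]; rewrite eqxx.
- by rewrite -big_mkcond/= -mulr_sumr qE mulVf.
- rewrite -(GE j) linear_sum scaler_sumr big_mkcond/=; apply: eq_bigr => i _.
  case: ifP => _; last by rewrite scale0r.
  by rewrite linearZ/= row_mxKl scalerA.
Qed.

(** All hulls share one point, so any [k] of them do; this also makes every part nonempty. *)
Lemma tverberg_partition (R : realType) (d s k : nat) :
  tverberg_property R d s.+1 k ((d + 1) * s).+1.
Proof.
move=> a; have [c [z cz]] := tverberg a.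
exists (fun j => [set i | c i = j]); last by move=> J _; exists z => j _; exact: cz.
split=> [|j j' _ _ [i [/= <- <-]]//|j _].
  by apply/seteqP; split=> // i _; exists (c i).
have /convex_hullP[t [_ tc t1 _]] := cz j.
have [i ti|t0] := pickP (fun i => t i != 0); first by exists i; exact: tc.
move: t1; rewrite big1 => [/esym/eqP|i _]; first by rewrite oner_eq0.
by have /eqP := t0 i.
Qed.

(** * Twelve points in dimension five *)

(* The displacement of [q_j] in the direction of the vertex [i], up to scale: one
   plus the adjacency matrix of a 5-cycle on 0..4 with an isolated vertex 5. *)
Definition weight (i j : nat) : nat :=
  (1 + [&& i < 5, j < 5 & (i.+1 %% 5 == j) || (j.+1 %% 5 == i)])%N.

Definition color_class (f : nat -> nat) (k : nat) : seq nat :=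
  [seq i <- iota 0 6 | f i == k].

(* The constraint which the clusters [A] shared by two parts put on the clusters
   [B] and [C] that each of these two parts shares with the third part. *)
Definition splits (A B C : seq nat) : bool :=
  match A with
  | [::] => false
  | [:: _] => nilp B || nilp C
  | [:: a; a'] =>
      allrel (fun b c => weight b a * weight c a' <= weight c a * weight b a')%N
        B C ||
      allrel (fun b c => weight c a * weight b a' <= weight b a * weight c a')%N
        B C
  | _ => true
  end.

Fixpoint words (n : nat) : seq (seq nat) :=
  if n is n'.+1 then [seq i :: s | i <- iota 0 4, s <- words n'] else [:: [::]].

Lemma mem_words (s : seq nat) : all (fun i => i < 4)%N s -> s \in words (size s).
Proof.
elim: s => // i s IHs /andP[i4 /IHs sw].
by apply: (@allpairs_f _ _ _ cons); rewrite ?mem_iota.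
Qed.

(** Empty classes fail, hence singletons fail too, and only classes of size two remain; the weights
    exclude these. Only [f] on 0..5 matters, so the 4^6 colourings are checked by computation. *)
Lemma not_all_splits (f : nat -> nat) : (forall i, f i < 4)%N ->
  ~~ [&& splits (color_class f 0) (color_class f 1) (color_class f 2),
         splits (color_class f 1) (color_class f 0) (color_class f 2) &
         splits (color_class f 2) (color_class f 0) (color_class f 1)].
Proof.
move=> f4; set s := mkseq f 6.
have fs k : color_class f k = color_class (nth 3 s) k.
  apply: eq_in_filter => i; rewrite mem_iota => /andP[_ i6].
  by rewrite nth_mkseq.
rewrite !fs.
have : s \in words 6.
  by rewrite -[6%N](size_mkseq f); apply: mem_words; apply/allP => _ /mapP[i _ ->].
by move: s {fs}; apply/allP; vm_compute.
Qed.

(** * Sign analysis of a relation between the clusters *)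

Lemma weight_bounds (R : numDomainType) i j : 1 <= ((weight i j)%:R : R) <= 2.
Proof. by rewrite ler1n ler_nat /weight; case: [&& _, _ & _]. Qed.

Lemma weight_cases i j : weight i j = 1%N \/ weight i j = 2%N.
Proof. by rewrite /weight; case: [&& _, _ & _]; [right|left]. Qed.

Lemma weighted_sum_le (R : realFieldType) (y : nat -> R) (e : R) (P : pred nat) i :
  0 <= e -> (forall j, (j < 6)%N -> P j -> `|y j| <= e) ->
  `|\sum_(0 <= j < 6 | P j) (weight i j)%:R * y j| <= 12 * e.
Proof.
move=> e0 ye; apply: le_trans (ler_norm_sum _ _ _) _.
apply: (@le_trans _ _ (\sum_(0 <= j < 6 | P j) 2 * e)).
  rewrite [leLHS]big_nat_cond [leRHS]big_nat_cond; apply: ler_sum => j.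
  move=> /andP[/andP[_ j6] Pj]; have /andP[w1 w2] := weight_bounds R i j.
  by rewrite normrM normr_nat ler_pM ?ye// normr_ge0.
rewrite big_mkcond (@le_trans _ _ (\sum_(0 <= j < 6) 2 * e))//.
  by apply: ler_sum => j _; case: ifP => // _; lra.
by rewrite sumr_const_nat subn0 -mulr_natr; lra.
Qed.

(* The largest [|y i|] is attained on class [k], where [x i] and [y i] may have
   opposite signs; outside class [k] every [y i] is smaller by a factor 80, so the
   sign constraints bear on the sums over class [k] up to an error [Y / 6]. *)
Lemma relation_splits (R : realFieldType) (f : nat -> nat) (k k1 k2 : nat)
    (x y d : nat -> R) :
  k1 != k -> k2 != k ->
  (forall i, (i < 6)%N -> 988 <= d i) ->
  (forall i, (i < 6)%N ->
     x i + d i * y i + \sum_(0 <= j < 6 | j != i) (weight i j)%:R * y j = 0) ->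
  (exists2 i, (i < 6)%N & y i != 0) ->
  (forall i, (i < 6)%N -> f i != k -> 0 <= x i * y i) ->
  (forall i, (i < 6)%N -> f i = k1 -> 0 <= x i /\ 0 <= y i) ->
  (forall i, (i < 6)%N -> f i = k2 -> x i <= 0 /\ y i <= 0) ->
  splits (color_class f k) (color_class f k1) (color_class f k2).
Proof.
move=> k1k k2k dge rel [i0 i06 yi0] xy_ge0 f1 f2.
case: (@arg_maxP _ _ _ (Ordinal i06) xpredT (fun i : 'I_6 => `|y i|) isT).
move=> m _ ymax; pose Y := `|y m|.
have yY j : (j < 6)%N -> `|y j| <= Y by move=> j6; exact: ymax (Ordinal j6) isT.
have Y0 : 0 < Y by apply: lt_le_trans (yY _ i06); rewrite normr_gt0.
(* Multiplying the relation by [y j] and dropping [x j * y j >= 0] gives [d j * |y j| <= 12 * Y],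
   and 12 / 988 < 1 / 80. *)
have small j : (j < 6)%N -> f j != k -> `|y j| <= Y / 80.
  move=> j6 fj; have := rel j j6; set S := \sum_(_ <= _ < _ | _) _ => relj.
  have SY : `|S| <= 12 * Y by apply: weighted_sum_le => [|l l6 _]; [lra|exact: yY].
  have [->|yj0] := eqVneq (y j) 0; first by rewrite normr0; lra.
  have xy := xy_ge0 _ j6 fj; have dj := dge j j6.
  have n0 : 0 < `|y j| by rewrite normr_gt0.
  have : d j * (`|y j| * `|y j|) <= 12 * Y * `|y j|.
    have -> : `|y j| * `|y j| = y j * y j.
      by rewrite -normrM ger0_norm// -expr2 sqr_ge0.
    have : - (S * y j) <= `|S| * `|y j| by rewrite -normrM -normrN ler_norm.
    have : `|S| * `|y j| <= 12 * Y * `|y j| by rewrite ler_wpM2r.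
    nra.
  rewrite mulrA ler_pM2r// => h; nra.
have fm : f m = k.
  apply/eqP; apply: contraT => fm.
  by have := small m (ltn_ord m) fm; rewrite -/Y; lra.
pose T i := \sum_(j <- color_class f k) (weight i j)%:R * y j.
(* The terms outside class [k] contribute at most 12 * Y / 80 < Y / 6. *)
have TE i : (i < 6)%N -> f i != k -> `|x i + d i * y i + T i| <= Y / 6.
  move=> i6 fi; have := rel i i6; rewrite (bigID (fun j => f j == k))/=.
  have -> : \sum_(0 <= j < 6 | (j != i) && (f j == k)) (weight i j)%:R * y j =
      T i.
    rewrite /T /color_class big_filter; apply: eq_bigl => j.
    by case: eqP => //= ->; rewrite (negbTE fi).
  set r := \sum_(_ <= _ < _ | _) _ => e.
  have : `|r| <= 12 * (Y / 80).
    by apply: weighted_sum_le => [|j j6 /andP[_ fj]]; [lra|exact: small].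
  rewrite addrA in e.
  have -> : x i + d i * y i + T i = - r by apply/eqP; rewrite -addr_eq0 e.
  by rewrite normrN; lra.
have T1 i : i \in color_class f k1 -> T i <= Y / 6.
  rewrite mem_filter mem_iota => /andP[/eqP fi /andP[_ i6]].
  have [xi yi] := f1 i i6 fi; have di := dge i i6.
  have := TE i i6; rewrite fi => /(_ k1k); rewrite ler_norml => /andP[_].
  have : 0 <= d i * y i by rewrite mulr_ge0//; lra.
  lra.
have T2 i : i \in color_class f k2 -> - (Y / 6) <= T i.
  rewrite mem_filter mem_iota => /andP[/eqP fi /andP[_ i6]].
  have [xi yi] := f2 i i6 fi; have di := dge i i6.
  have := TE i i6; rewrite fi => /(_ k2k); rewrite ler_norml => /andP[+ _].
  have : d i * y i <= 0 by rewrite mulr_ge0_le0//; lra.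
  lra.
have : val m \in color_class f k by rewrite mem_filter fm eqxx mem_iota ltn_ord.
rewrite /T in T1 T2; move: T1 T2 {T TE}.
(* The class contains [m], so it is not empty. If it is [[:: a]], then [|y a| = Y] and the sign of
   [y a] contradicts [T1] or [T2] unless the corresponding class is empty. *)
case: (color_class f k) => [|a [|a' [|? ?]]]//= T1 T2 mA.
- move: mA; rewrite inE => /eqP ma.
  have YE : Y = `|y a| by rewrite -ma.
  have [ya|ya] := leP (y a) 0.
    case: (color_class f k2) T2 => [|c C T2]; first by rewrite orbT.
    have := T2 c (mem_head _ _); rewrite big_seq1.
    by have /andP[? ?] := weight_bounds R c a; rewrite ler0_norm// in YE; nra.
  case: (color_class f k1) T1 => [//|b B T1].
  have := T1 b (mem_head _ _); rewrite big_seq1.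
  by have /andP[? ?] := weight_bounds R b a; rewrite gtr0_norm// in YE; nra.
have {}mA : Y = `|y a| \/ Y = `|y a'|.
  by move: mA; rewrite !inE => /orP[]/eqP ma; [left|right]; rewrite -ma.
have {}T1 b : b \in color_class f k1 ->
    (weight b a)%:R * y a + (weight b a')%:R * y a' <= Y / 6.
  by move=> /T1; rewrite big_cons big_seq1.
have {}T2 c : c \in color_class f k2 ->
    - (Y / 6) <= (weight c a)%:R * y a + (weight c a')%:R * y a'.
  by move=> /T2; rewrite big_cons big_seq1.
have YN u : Y = `|u| -> Y = u \/ Y = - u.
  move->; have [?|?] := leP 0 u; first by left; rewrite ger0_norm.
  by right; rewrite ltr0_norm.
have {}mA : [\/ Y = y a, Y = - y a, Y = y a' | Y = - y a'].
  by case: mA => /YN[]; [constructor 1|constructor 2|constructor 3|constructor 4].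
(* For a pair [b], [c] violating the order, the determinant of the weights is at least 1 in absolute
   value, so eliminating either unknown bounds the other on one side by 4 * Y / 6 < Y. This leaves
   only [y a' = - Y] (respectively [y a' = Y]), against [T2] (respectively [T1]). *)
have [ya|ya] := leP (y a) 0; apply/orP; [right|left];
  apply/allrelP => b c /T1 + /T2; rewrite leqNgt => Tb Tc;
  apply/negP; move: Tb Tc;
  have [->|->] := weight_cases b a; have [->|->] := weight_cases b a';
  have [->|->] := weight_cases c a; have [->|->] := weight_cases c a';
  rewrite ?mul1r//; case: mA => e; lra.
Qed.

(** * From meeting hulls to constraints on the clusters *)

(** The relation is the difference of the two convex representations of [z]; nothing cancels, as [A]
    and [B] are disjoint. *)
Lemma hulls_meet_relation (R : realType) (M : lmodType R) (n : nat)
    (a : 'I_n -> M) (A B : set 'I_n) (z : M) :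
  A `&` B = set0 -> convex_hull (a @` A) z -> convex_hull (a @` B) z ->
  exists g : 'I_n -> R,
    [/\ forall i, ~ A i -> g i <= 0, forall i, ~ B i -> 0 <= g i,
        exists i, g i != 0, \sum_i g i = 0 & \sum_i g i *: a i = 0].
Proof.
move=> AB /convex_hullP[s [s0 sA s1 zs]] /convex_hullP[t [t0 tB t1 zt]].
have sN i : ~ A i -> s i = 0 by move=> Ai; apply/eqP/negP => /negP/sA.
have tN i : ~ B i -> t i = 0 by move=> Bi; apply/eqP/negP => /negP/tB.
exists (fun i => s i - t i); split=> [i /sN->|i /tN->|||].
- by rewrite sub0r oppr_le0.
- by rewrite subr0.
- have [i si|s_0] := pickP (fun i => s i != 0).
    exists i; rewrite tN ?subr0// => Bi.
    suff : (A `&` B) i by rewrite AB.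
    by split=> //; exact: sA.
  move: s1; rewrite big1 => [/esym/eqP|i _]; first by rewrite oner_eq0.
  by have /eqP := s_0 i.
- by rewrite sumrB s1 t1 subrr.
- by under eq_bigr do rewrite scalerBl; rewrite sumrB -zs -zt subrr.
Qed.

(** Chosen so that the barycentric coordinates of the inner points sum to 1 after division by
    1000. *)
Definition diagonal (R : realType) (i : nat) : R :=
  1000 - \sum_(0 <= j < 6 | j != i) (weight j i)%:R.

(* The first six points are the vertices of a 5-simplex, the last six lie in
   its interior, the (6 + i)-th one close to the i-th vertex. *)
Definition barycentric (R : realType) (k : 'I_(6 + 6)) (j : 'I_6) : R :=
  match split k with
  | inl i => (j == i)%:R
  | inr i => (if j == i then diagonal R i else (weight j i)%:R) / 1000
  end.

(* Dropping the last barycentric coordinate identifies the affine hull of the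
   simplex with [R^5]. *)
Definition cluster_point (R : realType) (k : 'I_(6 + 6)) : 'rV[R]_5 :=
  \row_j barycentric R k (widen_ord (leqnSn 5) j).

Lemma sum_barycentric (R : realType) (k : 'I_(6 + 6)) :
  \sum_j barycentric R k j = 1.
Proof.
rewrite /barycentric; case: splitP => i _.
  by rewrite (bigD1 i)//= eqxx big1 ?addr0// => j /negbTE->.
rewrite -mulr_suml (bigD1 i)//= eqxx /diagonal big_mkord.
under eq_bigr => j /negbTE ji do rewrite ji.
by rewrite subrK; apply: divff; apply: lt0r_neq0; lra.
Qed.

Lemma diagonal_ge (R : realType) i : 988 <= diagonal R i.
Proof.
suff : \sum_(0 <= j < 6 | j != i) (weight j i)%:R <= 12 :> R.
  by rewrite /diagonal; lra.
rewrite big_mkcond (@le_trans _ _ (\sum_(0 <= j < 6) 2))//.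
  apply: ler_sum => j _; have := weight_bounds R j i.
  by case: ifP => _ /andP[? ?]; lra.
by rewrite sumr_const_nat subn0 -mulr_natr; lra.
Qed.

(** Five coordinates come from the points; the sixth follows because barycentric coordinates sum to
    1 and [g] sums to 0. *)
Lemma cluster_relation (R : realType) (g : 'I_(6 + 6) -> R) :
  \sum_k g k = 0 -> \sum_k g k *: cluster_point R k = 0 ->
  forall j, \sum_k g k * barycentric R k j = 0.
Proof.
move=> g0 gp.
have low (j : 'I_5) : \sum_k g k * barycentric R k (widen_ord (leqnSn 5) j) = 0.
  have /rowP/(_ j) := gp; rewrite summxE mxE => gpj; rewrite -[RHS]gpj.
  by apply: eq_bigr => k _; rewrite !mxE.
move=> j; have [j5|j5] := ltnP j 5.
  rewrite -[RHS](low (Ordinal j5)); apply: eq_bigr => k _.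
  by congr (_ * barycentric _ _ _); exact: val_inj.
have : \sum_(j < 6) \sum_k g k * barycentric R k j = 0.
  rewrite exchange_big -[RHS]g0; apply: eq_bigr => k _.
  by rewrite -mulr_sumr sum_barycentric mulr1.
rewrite big_ord_recr big1 /= => [|i _]; last exact: low.
rewrite add0r => gj; rewrite -[RHS]gj; apply: eq_bigr => k _.
congr (_ * barycentric _ _ _); apply/val_inj/eqP.
by rewrite eqn_leq/= j5 andbT -ltnS ltn_ord.
Qed.

Lemma cluster_relation_split (R : realType) (g : 'I_(6 + 6) -> R) (i : 'I_6) :
  \sum_k g k = 0 -> \sum_k g k *: cluster_point R k = 0 ->
  1000 * g (lshift 6 i) + diagonal R i * g (rshift 6 i) +
    \sum_(j < 6 | j != i) (weight i j)%:R * g (rshift 6 j) = 0.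
Proof.
move=> g0 gp; have := cluster_relation g0 gp i.
rewrite big_split_ord/= (bigD1 i)//= big1 => [|j ji]; last first.
  rewrite /barycentric (unsplitK (inl j)).
  by rewrite eq_sym (negbTE ji) mulr0.
rewrite addr0 {1}/barycentric (unsplitK (inl i)) eqxx mulr1 (bigD1 i)//=.
rewrite {1}/barycentric (unsplitK (inr i)) eqxx.
move/(congr1 ( *%R 1000)); rewrite mulr0 !mulrDr addrA => e.
rewrite -[RHS]e mulr_sumr; congr (_ + _ + _); first by field.
apply: eq_bigr => j ji.
by rewrite /barycentric (unsplitK (inr j)) eq_sym (negbTE ji); field.
Qed.

(* Cluster [i] is coloured by the part that misses it when its two points lie in
   different parts, and by 3 otherwise. *)
Definition missed_part (c : 'I_(6 + 6) -> 'I_3) (i : nat) : nat :=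
  let u := c (lshift 6 (inord i)) in let v := c (rshift 6 (inord i)) in
  if u == v then 3%N else (3 - u - v)%N.

Lemma hulls_meet_splits (R : realType) (c : 'I_(6 + 6) -> 'I_3) (u v w : 'I_3)
    z : uniq [:: u; v; w] ->
  convex_hull (cluster_point R @` [set i | c i = u]) z ->
  convex_hull (cluster_point R @` [set i | c i = v]) z ->
  splits (color_class (missed_part c) w) (color_class (missed_part c) v)
    (color_class (missed_part c) u).
Proof.
move=> uvw zu zv.
have uv : u != v by move: uvw => /=; rewrite !inE negb_or => /andP[/andP[]].
have disj : [set i | c i = u] `&` [set i | c i = v] = set0.
  by apply/seteqP; split=> // i [/= -> /eqP]; rewrite (negbTE uv).
have [g [gu gv [k gk] g0 gp]] := hulls_meet_relation disj zu zv.
pose x i := 1000 * g (lshift 6 (inord i)); pose y i := g (rshift 6 (inord i)).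
have rel i : (i < 6)%N -> x i + diagonal R i * y i +
    \sum_(0 <= j < 6 | j != i) (weight i j)%:R * y j = 0.
  move=> i6; rewrite -[RHS](cluster_relation_split (inord i) g0 gp) inordK//.
  congr (_ + _); rewrite big_mkord; apply: eq_big => [j|j _].
    by rewrite -val_eqE/= inordK.
  by rewrite /y inord_val.
have gneg i : c i != u -> g i <= 0 by move/eqP; exact: gu.
have gpos i : c i != v -> 0 <= g i by move/eqP; exact: gv.
have xu i : c (lshift 6 (inord i)) != u -> x i <= 0.
  by move=> /gneg ?; rewrite /x; lra.
have xv i : c (lshift 6 (inord i)) != v -> 0 <= x i.
  by move=> /gpos ?; rewrite /x; lra.
have [wv wu] : val v != val w /\ val u != val w.
  by move: uvw; rewrite /= !inE -!val_eqE/=; lia.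
have f3 i : (i < 6)%N -> forall t : 'I_3, missed_part c i = t ->
    c (lshift 6 (inord i)) != t /\ c (rshift 6 (inord i)) != t.
  move=> i6 t; rewrite /missed_part -!val_eqE/=.
  have := ltn_ord (c (lshift 6 (inord i))); have := ltn_ord (c (rshift 6 (inord i))).
  have := ltn_ord t; case: ifP; lia.
apply: (@relation_splits R _ _ _ _ x y (diagonal R)) => //.
- by move=> i _; exact: diagonal_ge.
(* If every [y j] vanished, the relation would involve only the vertices, which are affinely
   independent. *)
- have [j gj|g_0] := pickP (fun j => g (rshift 6 j) != 0).
    by exists j => //; rewrite /y inord_val.
  have y0 j : y j = 0 by have /negbFE/eqP := g_0 (inord j).
  have x0 i : (i < 6)%N -> x i = 0.
    by move=> /rel; rewrite y0 mulr0 addr0 big1 ?addr0// => j _; rewrite y0 mulr0.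
  move: gk; rewrite -(splitK k); case: (split k) => i /=; last first.
    by have := y0 i; rewrite /y inord_val => ->; rewrite eqxx.
  have := x0 i (ltn_ord i); rewrite /x inord_val => /eqP.
  by rewrite mulf_eq0 => /orP[/eqP|->//]; lra.
(* A cluster not coloured [w] avoids part [u] or part [v], so its two coefficients do not have
   opposite signs. *)
- move=> i i6 fi.
  have [[lu ru]|[lv rv]] :
      c (lshift 6 (inord i)) != u /\ c (rshift 6 (inord i)) != u \/
      c (lshift 6 (inord i)) != v /\ c (rshift 6 (inord i)) != v.
    move: fi uvw; rewrite /missed_part /= !inE -!val_eqE/=.
    have := ltn_ord (c (lshift 6 (inord i))); have := ltn_ord (c (rshift 6 (inord i))).
    have := ltn_ord u; have := ltn_ord v; have := ltn_ord w; case: ifP; lia.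
  + exact: mulr_le0 (xu _ lu) (gneg _ ru).
  + exact: mulr_ge0 (xv _ lv) (gpos _ rv).
- by move=> i i6 /(f3 i i6)[lv rv]; split; [exact: xv|exact: gpos].
- by move=> i i6 /(f3 i i6)[lu ru]; split; [exact: xu|exact: gneg].
Qed.

(** * Colourings of twelve points and the value of [T] *)

(** Reduces fewer points to exactly [n]: the added points all go to part 0, which only enlarges
    hulls. *)
Lemma pairwise_coloring (R : realType) (d r m n : nat) (mn : (m <= n)%N)
    (a : 'I_n -> 'rV[R]_d) :
  has_tverberg_partition r.+1 2 (a \o widen_ord mn) ->
  exists c : 'I_n -> 'I_r.+1, forall u v, u != v -> exists z,
    convex_hull (a @` [set i | c i = u]) z /\
    convex_hull (a @` [set i | c i = v]) z.
Proof.
move=> [N [Nc Nd _] Nz].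
have /boolp.choice[c cN] : forall i : 'I_n, exists j : 'I_r.+1,
    forall i' : 'I_m, widen_ord mn i' = i -> N j i'.
  move=> i; have [im|im] := ltnP i m; last first.
    by exists ord0 => i' ii; move: im; rewrite -ii leqNgt/= ltn_ord.
  have : cover [set: 'I_r.+1] N (Ordinal im) by rewrite Nc.
  move=> [j _ Nj]; exists j => i' ii.
  by have -> : i' = Ordinal im by apply: val_inj; exact: (congr1 val ii).
have sub j : (a \o widen_ord mn) @` N j `<=` a @` [set i | c i = j].
  move=> _ [i Ni <-]; exists (widen_ord mn i) => //=.
  by apply: Nd => //; exists i; split=> //; exact: cN.
have hull_sub j z : convex_hull ((a \o widen_ord mn) @` N j) z ->
    convex_hull (a @` [set i | c i = j]) z.
  by move=> hz C [cC aC]; apply: hz; split=> //; apply: subset_trans aC.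
exists c => u v uv; have [|z zuv] := Nz [set u; v]%SET; first by rewrite cards2 uv.
by exists z; split; apply: hull_sub; apply: zuv; rewrite /= !inE eqxx ?orbT.
Qed.

Lemma no_tverberg_property (R : realType) (m : nat) :
  (m <= 12)%N -> ~ tverberg_property R 5 3 2 m.
Proof.
move=> m12 /(_ (cluster_point R \o widen_ord m12)) /pairwise_coloring[c cz].
have f4 i : (missed_part c i < 4)%N by rewrite /missed_part; case: ifP => //; lia.
have sep (u v w : 'I_3) : uniq [:: u; v; w] ->
    splits (color_class (missed_part c) w) (color_class (missed_part c) v)
      (color_class (missed_part c) u).
  move=> uvw; have [|z [zu zv]] := cz u v; last exact: hulls_meet_splits zu zv.
  by move: uvw; rewrite /= inE negb_or => /andP[/andP[]].
pose o := @Ordinal 3.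
have /negP := not_all_splits f4; apply; apply/and3P; split.
- exact: (sep (o 2 isT) (o 1 isT) (o 0 isT) isT).
- exact: (sep (o 2 isT) (o 0 isT) (o 1 isT) isT).
- exact: (sep (o 1 isT) (o 0 isT) (o 2 isT) isT).
Qed.

Theorem theorem5 (R : realType) : T R 5 3 2 = 13%N.
Proof.
(* Three parts mean [s = 2], and (5 + 1) * 2 + 1 = 13. *)
have T13 : tverberg_property R 5 3 2 13 by exact: (@tverberg_partition R 5 2 2).
have Tge m : tverberg_property R 5 3 2 m -> (13 <= m)%N.
  by move=> Tm; rewrite ltnNge; apply/negP => /no_tverberg_property/(_ Tm).
apply: xget_unique => [|n [_ Tn nmin]]; first by split=> // m _; exact: Tge.
by apply/eqP; rewrite eqn_leq nmin//= Tge.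
Qed.
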